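(* Let $A_{00}\subset A_{01}\subset A_{11}$ and $A_{00}\subset A_{10}\subset A_{11}$ be unital inclusions of multi-matrix algebras forming a commuting square (with respect to a faithful tracial state $\mathrm{tr}$ on $A_{11}$ and the $\mathrm{tr}$-preserving conditional expectations $E_{ij}:A_{11}\to A_{ij}$, i.e. $E_{01}E_{10}=E_{00}$). Let $A_{ij}$ have $n_{ij}$ simple summands, let $T_{ij}^{kl}$ be the inclusion matrix of $A_{ij}\subset A_{kl}$, let $v^{11}=(v^{11}_k)_{k=1}^{n_{11}}$ be the trace vector of $\mathrm{tr}$ and $v^{ij}=(v^{ij}_k)_{k=1}^{n_{ij}}$ the trace vector of the restriction of $\mathrm{tr}$ to $A_{ij}$. Then for all $1\le p<\infty$, all $a_1,\dots,a_{n_{11}}\ge0$ and all $1\le i\le n_{00}$, $$\left(\sum_{j=1}^{n_{10}}\left(\sum_{l=1}^{n_{11}} \frac{(T_{10}^{11})_{jl}\, a_lv_l^{11}}{v_j^{10}}\right)^p \frac{(T_{00}^{10})_{ij}\, v_j^{10}}{v_i^{00}}\right)^{1/p} \le \sum_{k=1}^{n_{01}}\left(\sum_{l=1}^{n_{11}} \frac{(T_{01}^{11})_{kl}\, a_l^pv_l^{11}}{v_k^{01}}\right)^{1/p}\frac{(T_{00}^{01})_{ik}\, v_k^{01}}{v_i^{00}}.$$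
   Context: A multi-matrix algebra is a finite direct sum $\bigoplus_i M_{k_i}(\mathbb{C})$. For a unital inclusion $A_0=\bigoplus_{i=1}^{n_0}M_{k_i}(\mathbb{C})\subset\bigoplus_{j=1}^{n_1}M_{l_j}(\mathbb{C})=A_1$, the inclusion matrix $T=(m_{ij})$ has $m_{ij}$ equal to the multiplicity of the summand $M_{k_i}(\mathbb{C})$ in $M_{l_j}(\mathbb{C})$. For a faithful tracial state $\mathrm{tr}$ on $A_1$, the trace vector is $(v_j)_j$ with $v_j=\mathrm{tr}(q_j)$ for $q_j$ a minimal projection in the $j$-th summand. *)

(* Defs.v *)
From HB Require Import structures.
From mathcomp Require Import all_boot all_order all_algebra.
From mathcomp Require Import reals exp.
From mathcomp.real_closed Require Import complex.

Set Implicit Arguments.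
Unset Strict Implicit.
Unset Printing Implicit Defensive.

Import Order.TTheory GRing.Theory Num.Theory.
Local Open Scope ring_scope.

Section MultiMatrix.
Variables (R : realType) (N : nat).
Local Notation C := (R[i]).
Local Notation M := ('M[C]_N.+1).

Definition adj (x : M) : M := (map_mx (@conjc R) x)^T.

(* A unital *-subalgebra of M_{N+1}(C) (a concrete finite-dimensional
   C*-algebra, i.e. a multi-matrix algebra), given as a predicate. *)
Definition is_unital_star_subalg (A : M -> Prop) : Prop :=
  [/\ A 1,
      (forall x y, A x -> A y -> A (x + y)),
      (forall (c : C) x, A x -> A (c *: x)),
      (forall x y, A x -> A y -> A (x * y)) &
      (forall x, A x -> A (adj x))].

Definition subalg (B A : M -> Prop) : Prop := forall x, B x -> A x.

Definition is_proj (e : M) : Prop := adj e = e /\ e * e = e.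

Definition is_central (A : M -> Prop) (z : M) : Prop :=
  A z /\ forall x, A x -> z * x = x * z.

Definition is_min_central_proj (A : M -> Prop) (q : M) : Prop :=
  [/\ is_central A q, is_proj q, q != 0 &
      forall q', is_central A q' -> is_proj q' -> q' * q = q' ->
                 q' = 0 \/ q' = q].

Definition is_min_proj (A : M -> Prop) (e : M) : Prop :=
  [/\ A e, is_proj e, e != 0 &
      forall x, A x -> exists c : C, e * x * e = c *: e].

Definition enumerates_summands (A : M -> Prop) (n : nat) (z : 'I_n -> M) :=
  injective z /\ forall q, is_min_central_proj A q <-> exists i, q = z i.

Definition is_trace_vector (tau : M -> C) (A : M -> Prop) (n : nat)
    (z : 'I_n -> M) (v : 'I_n -> R) : Prop :=
  forall i e, is_min_proj A e -> e * z i = e -> tau e = real_complex R (v i).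

Definition splits_into (A : M -> Prop) (p : M) (m : nat) : Prop :=
  exists f : 'I_m -> M,
    [/\ forall a, is_min_proj A (f a),
        forall a b, a != b -> f a * f b = 0 &
        p = \sum_(a < m) f a].

(* T is the inclusion matrix of B (summands zB) inside A (summands zA):
   T i j = multiplicity of the i-th summand of B in the j-th summand of A,
   i.e. for a minimal projection f of B in the i-th summand, zA j * f
   is a sum of T i j minimal projections of A. *)
Definition is_inclusion_matrix (B A : M -> Prop) (nB nA : nat)
    (zB : 'I_nB -> M) (zA : 'I_nA -> M) (T : 'I_nB -> 'I_nA -> nat) : Prop :=
  forall i j f, is_min_proj B f -> f * zB i = f ->
    splits_into A (zA j * f) (T i j).

Definition is_faithful_tracial_state (A : M -> Prop) (tau : M -> C) : Prop :=
  [/\ (forall (c : C) x y, tau (c *: x + y) = c * tau x + tau y),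
      tau 1 = 1,
      (forall x y, A x -> A y -> tau (x * y) = tau (y * x)),
      (forall x, A x -> 0 <= tau (adj x * x)) &
      (forall x, A x -> tau (adj x * x) = 0 -> x = 0)].

Definition is_cond_exp (tau : M -> C) (A B : M -> Prop) (E : M -> M) : Prop :=
  forall x, A x -> B (E x) /\ forall y, B y -> tau (E x * y) = tau (x * y).

End MultiMatrix.

(* Main.v *)
(* Fix a minimal projection e of A00 in the i-th summand and put
   w_jkl = tau (z11_l z10_j e z01_k), which is nonnegative because it is the
   trace of a product of two projections.  Counting minimal projections, its sum
   over k is T_ij T_jl v_l and its sum over j is T_ik T_kl v_l, while the
   commuting square together with e A00 e = C e makes its sum over l a product
   of a function of j and a function of k.  So, under w, the indices j and k are
   independent, and the claim is the commutative inequality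
   || E(a | j) ||_p <= E( E(a^p | k)^(1/p) ), a single application of Jensen's
   inequality. *)
Require Import Defs.
From HB Require Import structures.
From mathcomp Require Import all_boot all_order all_algebra.
From mathcomp Require Import boolp reals exp.
From mathcomp.real_closed Require Import complex.
From mathcomp Require Import ring lra.
Import Order.TTheory GRing.Theory Num.Theory.
Local Open Scope ring_scope.

(** * Convexity of real powers and the commutative inequality *)

(** Young's inequality for the product of [t] and 1 with exponents [p] and [p / (p - 1)], multiplied
    by [p]. The case [p = 1], where the second exponent degenerates, is an equality. *)
Lemma bernoulli_powR {R : realType} {p : R} (t : R) :
  1 <= p -> 0 <= t -> 1 + p * (t - 1) <= t `^ p.
Proof.
rewrite le_eqVlt => /predU1P[<- t0|p1 t0]; first by rewrite powRr1//; lra.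
have p0 : 0 < p by lra.
have q0 : 0 < p - 1 by lra.
have := @conjugate_powR R t 1 p (p / (p - 1)) t0 ler01 p0 (divr_gt0 p0 q0).
rewrite powR1 mulr1 div1r invf_div.
have -> : p^-1 + (p - 1) / p = 1 by field; rewrite gt_eqF.
move=> /(_ erefl); rewrite -(ler_pM2l p0) mulrDr (mulrCA p (_ `^ _)) divff ?gt_eqF// mulr1.
rewrite (mulrCA p (p - 1)) divff ?gt_eqF// mulr1 => ?; lra.
Qed.

(** The tangent to the [p]-th power at the mean [m] lies below the graph, by Bernoulli's inequality
    at [x i / m]; averaging the tangent over [u] leaves [m] to the power [p]. *)
Lemma jensen_powR {R : realType} {I : finType} {p : R} (u x : I -> R) :
  1 <= p -> (forall i, 0 <= u i) -> (forall i, 0 <= x i) -> \sum_i u i = 1 ->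
  (\sum_i u i * x i) `^ p <= \sum_i u i * x i `^ p.
Proof.
move=> p1 u0 x0 u1; set m := \sum_i u i * x i.
have p0 : 0 < p by lra.
have m0 : 0 <= m by apply: sumr_ge0 => i _; rewrite mulr_ge0.
have [->|mn0] := eqVneq m 0.
  by rewrite powR0 ?gt_eqF//; apply: sumr_ge0 => i _; rewrite mulr_ge0// powR_ge0.
have tangent i : m `^ p * (1 + p * (x i / m - 1)) <= x i `^ p.
  rewrite -[x i in leRHS](divfK mn0) mulrC powRM ?divr_ge0//.
  by rewrite ler_wpM2r ?powR_ge0// bernoulli_powR// divr_ge0.
apply: (@le_trans _ _ (\sum_i u i * (m `^ p * (1 + p * (x i / m - 1))))).
  rewrite (_ : \sum_i _ = m `^ p * ((1 - p) * \sum_i u i + p / m * m)).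
    by rewrite u1 divfK// mulr1 subrK mulr1.
  rewrite /m !mulr_sumr -big_split/= mulr_sumr -/m.
  by apply: eq_bigr => i _; field.
by apply: ler_sum => i _; rewrite ler_wpM2l.
Qed.

(** Let [c k] be the conditional [p]-norm of [a] given [k], and [S] its average. For fixed [j], the
    factorization of the sums over [l] makes the weights [w j k l * c k / (alpha j * S)] sum to 1
    over [(k, l)], whatever [j] is. Jensen for [a l / c k], then summation over [j], replaces the
    [p]-th powers of [a] by [G k], that is, by the [p]-th power of [c k] times [beta k]. *)
Lemma conditional_minkowski {R : realType} {J K L : finType} {p V : R}
    (w : J -> K -> L -> R) (alpha : J -> R) (beta : K -> R) (a : L -> R) :
  1 <= p -> 0 < V ->
  (forall j k l, 0 <= w j k l) -> (forall l, 0 <= a l) ->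
  (forall j, 0 <= alpha j) -> (forall k, 0 <= beta k) ->
  (forall j k, \sum_l w j k l = alpha j * beta k / V) ->
  (\sum_j ((\sum_k \sum_l w j k l * a l) / alpha j) `^ p * (alpha j / V)) `^ p^-1
  <= \sum_k ((\sum_j \sum_l w j k l * a l `^ p) / beta k) `^ p^-1
       * (beta k / V).
Proof.
move=> p1 V0 w0 a0 al0 be0 wE.
have p0 : 0 < p by lra.
have pn0 : p != 0 by rewrite gt_eqF.
set G := fun k => \sum_j \sum_l w j k l * a l `^ p.
have G0 k : 0 <= G k.
  by apply: sumr_ge0 => j _; apply: sumr_ge0 => l _; rewrite mulr_ge0 ?powR_ge0.
set c := fun k => (G k / beta k) `^ p^-1.
have c0 k : 0 <= c k by apply: powR_ge0.
rewrite [leRHS](eq_bigr (fun k => c k * (beta k / V)))//.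
set S := \sum_k c k * (beta k / V).
have cp k : c k `^ p = G k / beta k.
  by rewrite /c -powRrM mulVf// powRr1// divr_ge0.
have S0 : 0 <= S.
  by apply: sumr_ge0 => k _; rewrite mulr_ge0// divr_ge0// ltW.
have w_be0 j k l : beta k = 0 -> w j k l = 0.
  move=> bk; move: (wE j k); rewrite bk mulr0 mul0r => /eqP.
  by rewrite psumr_eq0// => /allP/(_ l); rewrite mem_index_enum => /(_ isT)/eqP.
(* If [beta k = 0], the quotient defining [c k] is 0 by convention; the identity survives because
   the nonnegative [w j k l] then sum to 0 and vanish, so [G k = 0]. *)
have Gbe k : c k `^ p * beta k = G k.
  rewrite cp; have [bk|?] := eqVneq (beta k) 0; last by rewrite divfK.
  by rewrite bk mulr0 /G big1// => j _; rewrite big1// => l _; rewrite w_be0// mul0r.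
(* If [c k = 0] then [G k = 0], and each of its nonnegative terms vanishes. *)
have wc0 j k l : c k * beta k = 0 -> w j k l * a l = 0.
  move=> /eqP; rewrite mulf_eq0 => /orP[/eqP ck|/eqP/w_be0->]; last by rewrite mul0r.
  have := Gbe k; rewrite ck powR0// mul0r => /esym/eqP.
  rewrite psumr_eq0; last by move=> ? _; apply: sumr_ge0 => ? _; rewrite mulr_ge0 ?powR_ge0.
  move=> /allP/(_ j); rewrite mem_index_enum => /(_ isT).
  rewrite psumr_eq0; last by move=> ? _; rewrite mulr_ge0 ?powR_ge0.
  move=> /allP/(_ l); rewrite mem_index_enum => /(_ isT).
  by rewrite mulf_eq0 powR_eq0 => /orP[/eqP->|/andP[/eqP-> _]]; rewrite ?mul0r ?mulr0.
have Vn0 : V != 0 by rewrite gt_eqF.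
suff : \sum_j ((\sum_k \sum_l w j k l * a l) / alpha j) `^ p * (alpha j / V) <= S `^ p.
  move=> h; apply: (@le_trans _ _ ((S `^ p) `^ p^-1)).
    rewrite ge0_ler_powR ?invr_ge0 ?(ltW p0)// ?nnegrE ?powR_ge0//.
    by apply: sumr_ge0 => j _; rewrite mulr_ge0 ?powR_ge0// divr_ge0// ltW.
  by rewrite -powRrM divff// powRr1.
have [S_eq0|Sn0] := eqVneq S 0.
  rewrite big1 ?powR_ge0// => j _; rewrite big1 ?mul0r ?powR0 ?mul0r// => k _.
  rewrite big1// => l _; apply: wc0; move/eqP: S_eq0.
  rewrite psumr_eq0; last by move=> k' _; rewrite mulr_ge0// divr_ge0// ltW.
  move=> /allP/(_ k); rewrite mem_index_enum => /(_ isT)/=.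
  by rewrite mulrA mulf_eq0 invr_eq0 (negbTE Vn0) orbF => /eqP.
(* Jensen for the weights [w j k l * c k / (alpha j * S)] and the values
   [a l / c k]; where [c k = 0] the division gives 0, harmlessly by [wc0]. *)
have step j : ((\sum_k \sum_l w j k l * a l) / alpha j) `^ p * (alpha j / V) <=
    S `^ p * \sum_k \sum_l w j k l * c k / (V * S) * (a l / c k) `^ p.
  have [->|aln0] := eqVneq (alpha j) 0.
    rewrite mul0r mulr0 mulr_ge0 ?powR_ge0//.
    apply: sumr_ge0 => k _; apply: sumr_ge0 => l _.
    by rewrite mulr_ge0 ?powR_ge0// divr_ge0// mulr_ge0// ltW.
  set u := fun kl : K * L => w j kl.1 kl.2 * c kl.1 / (alpha j * S).
  set x := fun kl : K * L => a kl.2 / c kl.1.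
  have u1 : \sum_kl u kl = 1.
    rewrite -(pair_bigA _ (fun k l => u (k, l)))/= /u/=.
    rewrite (eq_bigr (fun k => c k * (beta k / V) / S)).
      by rewrite -mulr_suml divff.
    by move=> k _; rewrite -!mulr_suml wE; field; rewrite aln0 Sn0 Vn0.
  have ux : \sum_kl u kl * x kl = (\sum_k \sum_l w j k l * a l) / alpha j / S.
    rewrite -(pair_bigA _ (fun k l => u (k, l) * x (k, l)))/= /u/x/=.
    rewrite !mulr_suml; apply: eq_bigr => k _; rewrite !mulr_suml; apply: eq_bigr => l _.
    have [ck|ckn0] := eqVneq (c k) 0; last by field; rewrite aln0 Sn0 ckn0.
    by rewrite ck wc0 ?ck ?mul0r// mulr0 !mul0r.
  have u0 kl : 0 <= u kl by rewrite /u divr_ge0// mulr_ge0.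
  have x0 kl : 0 <= x kl by rewrite /x divr_ge0.
  have := @jensen_powR R _ p u x p1 u0 x0 u1; rewrite ux => J1.
  set P := (\sum_k _) / _ in J1 *.
  have P0 : 0 <= P.
    apply: divr_ge0 => //.
    by apply: sumr_ge0 => k _; apply: sumr_ge0 => l _; rewrite mulr_ge0.
  rewrite -[in leLHS](divfK Sn0 P) powRM ?(divr_ge0 P0)// mulrAC mulrC.
  rewrite ler_wpM2l ?powR_ge0//.
  apply: (@le_trans _ _ ((\sum_i u i * x i `^ p) * (alpha j / V))).
    by rewrite ler_wpM2r// divr_ge0// ltW.
  rewrite -(pair_bigA _ (fun k l => u (k, l) * x (k, l) `^ p))/= /u/x/=.
  rewrite mulr_suml le_eqVlt; apply/orP; left; apply/eqP.
  apply: eq_bigr => k _; rewrite mulr_suml; apply: eq_bigr => l _.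
  by field; rewrite aln0 Sn0 Vn0.
apply: le_trans (ler_sum _ (fun j _ => step j)) _.
rewrite -mulr_sumr -[leRHS]mulr1 ler_wpM2l ?powR_ge0//.
(* Writing 1 as the sum of the weights [c k * (beta k / V) / S] reduces the comparison to one [k] at
   a time. *)
rewrite exchange_big/= (_ : 1 = \sum_k c k * (beta k / V) / S); last first.
  by rewrite -mulr_suml divff.
apply: ler_sum => k _.
have [ck|ckn0] := eqVneq (c k) 0.
  rewrite ck !mul0r big1// => j _; rewrite big1// => l _.
  by rewrite mulr0 !mul0r.
have cpn0 : c k `^ p != 0 by rewrite powR_eq0 negb_and ckn0.
rewrite (eq_bigr (fun j => (\sum_l w j k l * a l `^ p) * (c k / (V * S) / c k `^ p))).
  rewrite -mulr_suml -/(G k) -Gbe le_eqVlt; apply/orP; left; apply/eqP.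
  by field; rewrite cpn0 Sn0 Vn0.
move=> j _; rewrite mulr_suml; apply: eq_bigr => l _.
rewrite powRM ?invr_ge0// -(powR_inv1 (c0 k)) -powRrM mulN1r powRN.
by field; rewrite cpn0 Sn0 Vn0.
Qed.

(** * Adjoints and spectral projections of hermitian matrices *)

Lemma adjK {R : realType} {N : nat} : involutive (@adj R N).
Proof. by move=> x; apply/matrixP => i j; rewrite !mxE conjcK. Qed.

Lemma adjD {R : realType} {N : nat} : {morph @adj R N : x y / x + y}.
Proof. by move=> x y; rewrite /adj map_mxD linearD. Qed.

Lemma adjB {R : realType} {N : nat} : {morph @adj R N : x y / x - y}.
Proof. by move=> x y; rewrite /adj map_mxB linearB. Qed.

Lemma adjM {R : realType} {N : nat} (x y : 'M[R[i]]_N.+1) :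
  adj (x * y) = adj y * adj x.
Proof. by rewrite /adj map_mxM trmx_mul. Qed.

Lemma adjZ {R : realType} {N : nat} (c : R[i]) (x : 'M_N.+1) :
  adj (c *: x) = conjc c *: adj x.
Proof. by rewrite /adj map_mxZ linearZ. Qed.

Lemma adj1 {R : realType} {N : nat} : adj 1 = 1 :> 'M[R[i]]_N.+1.
Proof. by rewrite /adj map_mx1 trmx1. Qed.

Lemma adj_sum {R : realType} {N : nat} {I : Type} (s : seq I) (P : pred I)
    (F : I -> 'M[R[i]]_N.+1) :
  adj (\sum_(i <- s | P i) F i) = \sum_(i <- s | P i) adj (F i).
Proof. by rewrite /adj map_mx_sum linear_sum. Qed.

Lemma hermitian_diagonalization {R : realType} {N : nat} (h : 'M[R[i]]_N.+1) :
  adj h = h ->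
  exists (U : 'M[R[i]]_N.+1) (d : 'rV[R[i]]_N.+1),
    U * adj U = 1 /\ h = adj U * diag_mx d * U.
Proof.
move=> hh.
have conjE (x : 'M[R[i]]_N.+1) : map_mx Num.conj x^T = adj x.
  by rewrite -map_trmx.
have /orthomx_spectralP : h \is normalmx.
  by apply/normalmxP; rewrite conjE hh.
have := spectral_unitarymx h.
move: (spectralmx h) (spectral_diag h) => U d Uu hE.
exists U, d; split; first by rewrite -conjE; exact/unitarymxP.
have UE : invmx U = adj U by rewrite -conjE; exact: invmx_unitary.
rewrite UE in hE; rewrite {1}hE.
(* Unless [adj U] is abstract, the conversion of the two ring structures unfolds it. *)
by move: (adj U) (diag_mx d) => V D; rewrite !mulmxE.
Qed.

Lemma horner_mx_similar {F : comNzRingType} {n : nat} {U V D : 'M[F]_n.+1}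
    (q : {poly F}) :
  U * V = 1 -> V * U = 1 -> horner_mx (V * D * U) q = V * horner_mx D q * U.
Proof.
move=> UV VU; elim/poly_ind: q => [|q c IH]; first by rewrite !rmorph0 mulr0 mul0r.
rewrite !rmorphD !rmorphM/= !horner_mx_X !horner_mx_C IH mulrDr mulrDl.
congr (_ + _); last by rewrite -[c%:M]scalemx1 -scalerAr mulr1 -scalerAl VU.
by rewrite -!mulrA (mulrA U) UV mul1r.
Qed.

(** Having the spectral projections as polynomials in [h] keeps them in every unital subalgebra
    containing [h], and makes them commute with whatever commutes with [h]. *)
Lemma hermitian_spectral_polys {R : realType} {N : nat} (h : 'M[R[i]]_N.+1) :
  adj h = h ->
  exists (s : seq R[i]) (P : R[i] -> {poly R[i]}),
    (forall c, is_proj (horner_mx h (P c))) /\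
    h = \sum_(c <- s) c *: horner_mx h (P c).
Proof.
move=> /hermitian_diagonalization[U [d [UU hE]]].
have hp (q : {poly R[i]}) :
    horner_mx h q = adj U * diag_mx (map_mx (horner q) d) * U.
  by rewrite hE (horner_mx_similar _ UU (mulmx1C UU)) horner_mx_diag.
pose s := undup [seq d 0 i | i : 'I_N.+1].
have ds i : d 0 i \in s by rewrite mem_undup map_f// mem_enum.
(* Lagrange interpolation: on [s], [P c] is the indicator of [c]. For [c] outside [s] it vanishes on
   all of [s], which gives the zero projection. *)
pose P c : {poly R[i]} := \prod_(b <- s | b != c) ((c - b)^-1 *: ('X - b%:P)).
have Pd c i : (P c).[d 0 i] = (d 0 i == c)%:R.
  rewrite /P horner_prod; have [<-|dc] := eqVneq.
    rewrite big1// => b bd; rewrite !hornerE mulVf// subr_eq0 eq_sym//.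
  by rewrite (big_rem _ (ds i))/= dc !hornerE subrr mulr0 mul0r.
exists s, P; split.
  move=> c; rewrite hp; set D := diag_mx _.
  have Dadj : adj D = D.
    rewrite /adj map_diag_mx tr_diag_mx; congr diag_mx.
    by apply/rowP => i; rewrite !mxE Pd; exact: conjc_nat.
  have DD : D *m D = D.
    rewrite mulmx_diag; congr diag_mx.
    by apply/rowP => i; rewrite !mxE Pd -natrM mulnb andbb.
  move: D Dadj DD => D Dadj; rewrite mulmxE => DD.
  split; first by rewrite !adjM adjK Dadj mulrA.
  by rewrite -!mulrA (mulrA U) UU mul1r (mulrA D) DD.
have -> : \sum_(c <- s) c *: horner_mx h (P c) = horner_mx h (\sum_(c <- s) c *: P c).
  by rewrite linear_sum; apply: eq_bigr => c _; rewrite linearZ.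
rewrite hp [LHS]hE; congr (_ * diag_mx _ * _).
apply/rowP => i; rewrite !mxE horner_sum (big_rem _ (ds i))/= hornerZ Pd eqxx mulr1.
rewrite big_seq big1 ?addr0// => c; rewrite mem_rem_uniq ?undup_uniq// inE => /andP[cd _].
by rewrite hornerZ Pd eq_sym (negbTE cd) mulr0.
Qed.

(** * Minimal projections and the decomposition of the unit *)

Lemma mxrank_minimal {R : realType} {N : nat} (P : 'M[R[i]]_N.+1 -> Prop) x : P x ->
  exists2 y, P y & forall y', P y' -> (\rank y <= \rank y')%N.
Proof.
move=> Px; have ex : exists n, `[<exists2 y, P y & \rank y = n>].
  by exists (\rank x); apply/asboolP; exists x.
case: (ex_minnP ex) => n /asboolP[y Py <-] ymin.
by exists y => // y' Py'; apply: ymin; apply/asboolP; exists y'.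
Qed.

(** The relation [f * e = f] puts the row space of [f] inside that of [e]; the rank bound makes them
    equal, so [e * f = e]. Taking adjoints in [f * e = f] gives [e * f = f]. *)
Lemma subproj_eq {R : realType} {N : nat} {e f : 'M[R[i]]_N.+1} :
  is_proj e -> is_proj f -> f * e = f -> (\rank e <= \rank f)%N -> f = e.
Proof.
move=> [ea ee] [fa ff] fe ef.
have sfe : (f <= e)%MS by rewrite -fe submxMl.
have /submxP[D eD] : (e <= f)%MS.
  by rewrite -(geq_leqif (mxrank_leqif_sup sfe)).
have ef_e : e * f = e by rewrite eD -[_ * f]mulmxA [f *m f]ff.
by rewrite -fa -fe adjM fa ea ef_e.
Qed.

Section Subalgebra.
Context {R : realType} {N : nat} {A : 'M[R[i]]_N.+1 -> Prop}.
Hypothesis hA : is_unital_star_subalg A.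
Implicit Types (x y e f q : 'M[R[i]]_N.+1) (c : R[i]).

Lemma subalg1 : A 1. Proof. by case: hA. Qed.
Lemma subalgD x y : A x -> A y -> A (x + y). Proof. by case: hA => _ + *; apply. Qed.
Lemma subalgZ c x : A x -> A (c *: x). Proof. by case: hA => _ _ + *; apply. Qed.
Lemma subalgM x y : A x -> A y -> A (x * y). Proof. by case: hA => _ _ _ + *; apply. Qed.
Lemma subalg_adj x : A x -> A (adj x). Proof. by case: hA => _ _ _ _; apply. Qed.
Lemma subalg0 : A 0. Proof. by rewrite -(scale0r 1); apply/subalgZ/subalg1. Qed.
Lemma subalgB x y : A x -> A y -> A (x - y).
Proof. by move=> Ax Ay; rewrite -scaleN1r; apply: subalgD => //; apply: subalgZ. Qed.

Lemma subalg_sum {I : Type} (s : seq I) (P : pred I) (F : I -> 'M_N.+1) :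
  (forall i, P i -> A (F i)) -> A (\sum_(i <- s | P i) F i).
Proof. by move=> AF; apply: (big_ind A) => //; [exact: subalg0|exact: subalgD]. Qed.

Lemma subalg_horner_mx x (r : {poly R[i]}) : A x -> A (horner_mx x r).
Proof.
move=> Ax; elim/poly_ind: r => [|r c IH]; first by rewrite rmorph0; exact: subalg0.
rewrite rmorphD rmorphM/= horner_mx_X horner_mx_C -scalemx1.
by apply: subalgD; [exact: subalgM|apply/subalgZ/subalg1].
Qed.

(* A projection [e] of minimal rank works: for hermitian [h] the spectral
   projections of [e * h * e] cut [e] into subprojections in [A], each 0 or [e]. *)
Lemma exists_min_proj q : A q -> is_proj q -> q != 0 ->
  exists e, is_min_proj A e /\ e * q = e.
Proof.
move=> Aq qp q0.
pose P e := [/\ A e, is_proj e, e != 0 & e * q = e].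
have [|e [Ae ep e0 eq] emin] := mxrank_minimal P q.
  by split=> //; case: qp.
exists e; split=> //; split=> // {q0 qp Aq}.
have [ea ee] := ep.
have herm h : A h -> adj h = h -> exists c, e * h * e = c *: e.
  move=> Ah hh; set k := e * h * e.
  have Ak : A k by apply: subalgM => //; exact: subalgM.
  have ke : k * e = k by rewrite /k -!mulrA ee.
  have ek : e * k = k by rewrite /k !mulrA ee.
  have [|s [r [rp kE]]] := hermitian_spectral_polys k.
    by rewrite /k !adjM ea hh mulrA.
  (* As [e] commutes with [k], it commutes with polynomials in [k]. The spectral projection at 0
     contains [1 - e], so each one is multiplied by [e] before minimality is applied. *)
  have er c : GRing.comm e (horner_mx k (r c)).
    by apply: comm_mx_horner; rewrite /comm_mx !mulmxE ke ek.
  have /choice[b bE] : forall c, exists b : R[i], e * horner_mx k (r c) = b *: e.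
    move=> c; have [->|n0] := eqVneq (e * horner_mx k (r c)) 0.
      by exists 0; rewrite scale0r.
    have [ra rr] := rp c.
    have erE : e * horner_mx k (r c) * e = e * horner_mx k (r c).
      by rewrite -mulrA -er mulrA ee.
    have pr : is_proj (e * horner_mx k (r c)).
      by split; [rewrite adjM ra ea er|rewrite mulrA erE -mulrA rr].
    exists 1; rewrite scale1r; apply: subproj_eq => //.
    apply: emin; split=> //.
    - by apply: subalgM => //; exact: subalg_horner_mx.
    - by rewrite er -mulrA eq.
  exists (\sum_(c <- s) c * b c).
  rewrite -ek kE mulr_sumr scaler_suml; apply: eq_bigr => c _.
  by rewrite -scalerAr bE scalerA.
move=> x Ax.
(* A general [x] is a combination of the hermitian elements [x + adj x] and
   ['i%C *: (x - adj x)]. *)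
have [|| c1 h1] := herm (x + adj x).
- by apply: subalgD => //; exact: subalg_adj.
- by rewrite adjD adjK addrC.
have [|| c2 h2] := herm ('i%C *: (x - adj x)).
- by apply/subalgZ/subalgB => //; exact: subalg_adj.
- rewrite adjZ adjB adjK -opprB scalerN -scaleNr; congr (_ *: _).
  by apply/eqP; rewrite eq_complex/= !oppr0 opprK !eqxx.
exists (2^-1 * (c1 - 'i%C * c2)).
have xE : x = 2^-1 *: (x + adj x - 'i%C *: ('i%C *: (x - adj x))).
  rewrite scalerA -expr2 sqr_i scaleN1r opprK addrACA subrr addr0.
  by rewrite -mulr2n -(scaler_nat 2 x) scalerA mulVf ?scale1r// pnatr_eq0.
rewrite {1}xE -scalerAr -scalerAl mulrBr mulrBl h1.
by rewrite -scalerAr -scalerAl h2 scalerA -scalerBl scalerA.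
Qed.

Lemma central_proj_sub1 q : is_central A q -> is_proj q ->
  is_central A (1 - q) /\ is_proj (1 - q).
Proof.
move=> [Aq cq] [qa qq]; split; split.
- by apply: subalgB => //; exact: subalg1.
- by move=> x Ax; rewrite mulrBl mulrBr cq// mul1r mulr1.
- by rewrite adjB adj1 qa.
- by rewrite mulrBr mulr1 mulrBl mul1r qq subrr subr0.
Qed.

(** A nonzero central projection under [q] of least rank is minimal, by [subproj_eq]. *)
Lemma exists_min_central_proj q : is_central A q -> is_proj q -> q != 0 ->
  exists f, is_min_central_proj A f /\ f * q = f.
Proof.
move=> cq qp q0.
pose P f := [/\ is_central A f, is_proj f, f != 0 & f * q = f].
have [|f [cf fp f0 fq] fmin] := mxrank_minimal P q.
  by split=> //; case: qp.
exists f; split=> //; split=> // g cg gp gf.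
have [->|g0] := eqVneq g 0; [by left|right].
apply: subproj_eq => //; apply: fmin; split=> //.
by rewrite -gf -mulrA fq.
Qed.

(** The product is a central projection under both factors; were it nonzero, minimality would equate
    it with each. *)
Lemma min_central_proj_ortho e f : is_min_central_proj A e ->
  is_min_central_proj A f -> e != f -> e * f = 0.
Proof.
move=> [[Ae ce] [ea ee] e0 emin] [[Af cf] [fa ff] f0 fmin] nef.
have cp : is_central A (e * f).
  split; first exact: subalgM.
  by move=> x Ax; rewrite -mulrA cf// mulrA ce// mulrA.
have pp : is_proj (e * f).
  split; first by rewrite adjM ea fa cf.
  by rewrite mulrA -(mulrA e f e) cf// mulrA ee -mulrA ff.
have [//|h1] := emin _ cp pp ltac:(by rewrite -mulrA cf// mulrA ee).
have [//|h2] := fmin _ cp pp ltac:(by rewrite -mulrA ff).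
by move: nef; rewrite -h1 h2 eqxx.
Qed.

(** Otherwise the complement of the sum would dominate a minimal central projection, which is some
    [z k] and yet is orthogonal to the complement. *)
Lemma sum_summands {n : nat} (z : 'I_n -> 'M_N.+1) :
  enumerates_summands A z -> \sum_k z k = 1.
Proof.
move=> [zinj zP].
have zm k : is_min_central_proj A (z k) by apply/zP; exists k.
have zz k : z k * \sum_k z k = z k.
  rewrite mulr_sumr (bigD1 k)//= big1 ?addr0; first by case: (zm k) => _ [].
  move=> j jk; apply: min_central_proj_ortho => //.
  by apply/eqP => /zinj kj; rewrite kj eqxx in jk.
have sc : is_central A (\sum_k z k).
  split; first by apply: subalg_sum => k _; case: (zm k) => -[].
  move=> x Ax; rewrite mulr_suml mulr_sumr; apply: eq_bigr => k _.
  by case: (zm k) => -[_ ->].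
have sp : is_proj (\sum_k z k).
  split; first by rewrite adj_sum; apply: eq_bigr => k _; case: (zm k) => _ [].
  by rewrite {1}mulr_suml; apply: eq_bigr => k _; rewrite zz.
have [rc rp] := central_proj_sub1 _ sc sp.
apply/eqP/negPn/negP => s1.
have [|f [fm fr]] := exists_min_central_proj _ rc rp.
  by rewrite subr_eq0 eq_sym.
have /zP[k fk] := fm; case: fm => _ _ /eqP + _; apply.
by rewrite -fr fk mulrBr mulr1 zz subrr.
Qed.

End Subalgebra.

Lemma projM {R : realType} {N : nat} {x y : 'M[R[i]]_N.+1} :
  is_proj x -> is_proj y -> x * y = y * x -> is_proj (x * y).
Proof.
move=> [xa xx] [ya yy] xy; split; first by rewrite adjM xa ya xy.
by rewrite mulrA -(mulrA x y x) -xy mulrA xx -mulrA yy.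
Qed.

(** * Positivity of the trace and conditional expectations *)

Section Trace.
Context {R : realType} {N : nat} {A : 'M[R[i]]_N.+1 -> Prop}.
Context {tau : 'M[R[i]]_N.+1 -> R[i]}.
Hypothesis hA : is_unital_star_subalg A.
Hypothesis htau : is_faithful_tracial_state A tau.
Implicit Types (x y e f : 'M[R[i]]_N.+1) (c : R[i]) (B : 'M[R[i]]_N.+1 -> Prop).

Lemma tau_lin c x y : tau (c *: x + y) = c * tau x + tau y.
Proof. by case: htau. Qed.
Lemma tau_cyclic x y : A x -> A y -> tau (x * y) = tau (y * x).
Proof. by case: htau => _ _ + _ _; apply. Qed.
Lemma tau0 : tau 0 = 0.
Proof. by have := tau_lin (-1) 0 0; rewrite scaler0 addr0 mulN1r addNr. Qed.
Lemma tauD x y : tau (x + y) = tau x + tau y.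
Proof. by have := tau_lin 1 x y; rewrite scale1r mul1r. Qed.
Lemma tauZ c x : tau (c *: x) = c * tau x.
Proof. by have := tau_lin c x 0; rewrite tau0 !addr0. Qed.
Lemma tau_sum {I : Type} (s : seq I) (P : pred I) (F : I -> 'M_N.+1) :
  tau (\sum_(i <- s | P i) F i) = \sum_(i <- s | P i) tau (F i).
Proof. exact: (big_morph _ tauD tau0). Qed.

Lemma tau_proj_gt0 e : A e -> is_proj e -> e != 0 -> 0 < tau e.
Proof.
move=> Ae [ea ee] e0; case: htau => _ _ _ /(_ e Ae) + /(_ e Ae).
rewrite ea ee => te te0; rewrite lt0r te andbT.
by apply/eqP => /te0/eqP; apply/negP.
Qed.

(** By cyclicity the trace of [e * f] is that of [f * e * f], which is [adj (e * f) * (e * f)]. *)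
Lemma tau_mul_proj_ge0 e f : A e -> A f -> is_proj e -> is_proj f ->
  0 <= tau (e * f).
Proof.
move=> Ae Af [ea ee] [fa ff].
have Aef := subalgM hA _ _ Ae Af; have Afe := subalgM hA _ _ Af Ae.
have -> : tau (e * f) = tau (adj (e * f) * (e * f)).
  rewrite adjM ea fa (mulrA _ e) -(mulrA f) ee [RHS]tau_cyclic//.
  by rewrite mulrA ff tau_cyclic.
by case: htau => _ _ _ + _; apply.
Qed.

(** The difference [E x - x] lies in [B] and is trace-orthogonal to [B], in particular to its own
    adjoint, so faithfulness kills it. *)
Lemma cond_exp_id B E x : is_unital_star_subalg B -> subalg B A ->
  is_cond_exp tau A B E -> B x -> E x = x.
Proof.
move=> hB sBA hE Bx; have [BEx tE] := hE _ (sBA _ Bx).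
set d := E x - x; have Bd : B d by exact: (subalgB hB).
have td : tau (d * adj d) = 0.
  rewrite /d mulrBl -[- (x * _)]scaleN1r addrC tau_lin mulN1r.
  by rewrite tE ?addNr//; exact: (subalg_adj hB).
have : adj d = 0.
  case: htau => _ _ _ _ faith; apply: (faith _ (sBA _ (subalg_adj hB _ Bd))).
  by rewrite adjK.
move=> /(congr1 (@adj R N)); rewrite adjK => d0.
by apply/eqP; rewrite -subr_eq0 -/d d0 /adj map_mx0 trmx0.
Qed.

End Trace.

(** * Counting minimal projections through inclusion matrices *)

(** The functional [phi] is left general because it is taken to be both [tau] and [tau] after
    multiplication by a central projection of a larger algebra. *)
Lemma splits_into_sum {R : realType} {N : nat} {A : 'M[R[i]]_N.+1 -> Prop}
    {z e : 'M[R[i]]_N.+1} {m : nat} (phi : 'M[R[i]]_N.+1 -> R[i]) (t : R[i]) :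
  A e -> is_central A z -> is_proj z ->
  phi 0 = 0 -> {morph phi : x y / x + y} ->
  (forall f, is_min_proj A f -> f * z = f -> phi f = t) ->
  splits_into A (z * e) m ->
  phi (z * e) = m%:R * t /\
  ((0 < m)%N -> exists2 f, is_min_proj A f & f * z = f).
Proof.
move=> Ae [Az cz] [_ zz] phi0 phiD phit [f [fm ortho zeE]].
(* By orthogonality each piece absorbs [z * e], hence also the central projection [z], so it lies in
   the summand of [z]. *)
have fz a : f a * z = f a.
  have fze : f a * (z * e) = f a.
    rewrite zeE mulr_sumr (bigD1 a)//= big1 ?addr0; first by case: (fm a) => _ [].
    by move=> b ba; rewrite ortho// eq_sym.
  by rewrite -[in LHS]fze -mulrA (cz e Ae) -[e * z * z]mulrA zz -cz.
split; last by move=> m0; exists (f (Ordinal m0)).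
rewrite zeE (big_morph phi phiD phi0) (eq_bigr (fun=> t)).
  by rewrite sumr_const card_ord mulr_natl.
by move=> a _; apply: phit.
Qed.

Lemma enumerates_summandsP {R : realType} {N n : nat} {A : 'M[R[i]]_N.+1 -> Prop}
    {z : 'I_n -> 'M[R[i]]_N.+1} :
  enumerates_summands A z -> forall k, is_min_central_proj A (z k).
Proof. by move=> [_ zP] k; apply/zP; exists k. Qed.

(** The counting is done twice: the pieces of [zA j * e] are minimal in [A], and each of them, cut
    by [zC l], splits again into minimal projections of [C]. A nonzero [T i j] exhibits a minimal
    projection in the [j]-th summand, whose trace is positive. *)
Lemma trace_inclusion {R : realType} {N nB nA nC : nat}
    {B A C : 'M[R[i]]_N.+1 -> Prop} {tau : 'M[R[i]]_N.+1 -> R[i]}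
    {zB : 'I_nB -> 'M[R[i]]_N.+1} {zA : 'I_nA -> 'M[R[i]]_N.+1}
    {zC : 'I_nC -> 'M[R[i]]_N.+1} {vA : 'I_nA -> R} {vC : 'I_nC -> R}
    {T : 'I_nB -> 'I_nA -> nat} {T' : 'I_nA -> 'I_nC -> nat}
    {i : 'I_nB} {e : 'M[R[i]]_N.+1} :
  is_faithful_tracial_state C tau -> subalg B A -> subalg A C ->
  enumerates_summands A zA -> enumerates_summands C zC ->
  is_trace_vector tau A zA vA -> is_trace_vector tau C zC vC ->
  is_inclusion_matrix B A zB zA T -> is_inclusion_matrix A C zA zC T' ->
  is_min_proj B e -> e * zB i = e ->
  [/\ forall j, tau (zA j * e) = real_complex R ((T i j)%:R * vA j),
      forall j l, tau (zC l * (zA j * e)) =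
        real_complex R ((T i j)%:R * ((T' j l)%:R * vC l)) &
      forall j, T i j != 0 -> 0 < vA j].
Proof.
move=> htau sBA sAC /enumerates_summandsP hzA /enumerates_summandsP hzC.
move=> hvA hvC hT hT' em ez.
have Ae : A e by case: em => /sBA.
have castM (m : nat) (t : R) : m%:R * real_complex R t = real_complex R (m%:R * t).
  by rewrite rmorphM rmorph_nat.
have [zcA zpA] : (forall j, is_central A (zA j)) /\ (forall j, is_proj (zA j)).
  by split=> j; case: (hzA j).
have trA j := splits_into_sum tau _ Ae (zcA j) (zpA j) (tau0 htau) (tauD htau)
  (hvA j) (hT i j e em ez).
split=> [j|j l|j].
- by rewrite (trA j).1 castM.
- have phiD : {morph (fun x => tau (zC l * x)) : x y / x + y}.
    by move=> x y; rewrite mulrDr (tauD htau).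
  have phi0 : tau (zC l * 0) = 0 by rewrite mulr0 (tau0 htau).
  have [] := splits_into_sum (fun x => tau (zC l * x))
    (real_complex R ((T' j l)%:R * vC l)) Ae (zcA j) (zpA j) phi0 phiD _ (hT i j e em ez).
    move=> f fm fz; have [zc zp _ _] := hzC l.
    have Cf : C f by case: fm => /sAC.
    have [-> _] := splits_into_sum tau _ Cf zc zp (tau0 htau) (tauD htau)
      (hvC l) (hT' j l f fm fz).
    by rewrite castM.
  by move=> -> _; rewrite castM.
- rewrite -lt0n => /(trA j).2[f fm fz].
  have := hvA j f fm fz; case: fm => /sAC Cf fp f0 _ tf.
  by have := tau_proj_gt0 htau _ Cf fp f0; rewrite tf ltcR.
Qed.

(** * Independence from the commuting square *)

(** Since [E10] fixes [x], the commuting square gives [E01 x = E00 x], and [x] may be replaced by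
    [E00 x] in the trace against [e * y]. Minimality of [e] then turns [e * E00 x * e] into a scalar
    [c] times [e]; taking the unit for [y] identifies [c]. *)
Lemma commuting_square_factor {R : realType} {N : nat}
    {A00 A01 A10 A11 : 'M[R[i]]_N.+1 -> Prop} {tau : 'M[R[i]]_N.+1 -> R[i]}
    {E00 E01 E10 : 'M[R[i]]_N.+1 -> 'M[R[i]]_N.+1} {e x y : 'M[R[i]]_N.+1} :
  is_unital_star_subalg A01 -> is_unital_star_subalg A10 ->
  is_unital_star_subalg A11 -> subalg A00 A01 -> subalg A01 A11 ->
  subalg A10 A11 ->
  is_faithful_tracial_state A11 tau -> is_cond_exp tau A11 A00 E00 ->
  is_cond_exp tau A11 A01 E01 -> is_cond_exp tau A11 A10 E10 ->
  (forall x, A11 x -> E01 (E10 x) = E00 x) ->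
  is_min_proj A00 e -> A10 x -> A01 y -> e * y = y * e ->
  tau (x * e * y) * tau e = tau (x * e) * tau (y * e).
Proof.
move=> hA01 hA10 hA11 s00_01 s01 s10 htau hE00 hE01 hE10 hcomm.
move=> [A00e [_ ee] _ emin] A10x A01y eyC.
have A01e := s00_01 _ A00e; have A11e := s01 _ A01e.
have A11x := s10 _ A10x; have A11y := s01 _ A01y.
have [A00Ex tE00] := hE00 _ A11x; have [_ tE01] := hE01 _ A11x.
have A11Ex := s01 _ (s00_01 _ A00Ex).
have EE : E01 x = E00 x.
  by rewrite -hcomm// (cond_exp_id htau _ _ _ hA10 s10 hE10).
have [c cE] := emin _ A00Ex.
(* Cyclicity brings the last [e] to the front, so that [E00 x] stands between two copies of [e]. *)
have exE u : A11 u -> tau (E00 x * e * u * e) = c * tau (e * u).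
  move=> A11u; rewrite (tau_cyclic htau)//; last by do 2?apply: (subalgM hA11).
  by rewrite !mulrA cE -scalerAl (tauZ htau).
have xe : tau (x * e) = c * tau e.
  by have := exE 1 (subalg1 hA11); rewrite !mulr1 -mulrA ee tE00.
have xey : tau (x * e * y) = c * tau (e * y).
  rewrite -mulrA -tE01; last by apply: (subalgM hA01).
  by rewrite EE -[in LHS]ee -(mulrA e) [in LHS]eyC !mulrA exE.
by rewrite xey xe -eyC -!mulrA (mulrC (tau (e * y))).
Qed.

Theorem theoremB (R : realType) (N : nat)
  (A00 A01 A10 A11 : 'M[R[i]]_N.+1 -> Prop)
  (tau : 'M[R[i]]_N.+1 -> R[i])
  (E00 E01 E10 : 'M[R[i]]_N.+1 -> 'M[R[i]]_N.+1)
  (n00 n01 n10 n11 : nat)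
  (z00 : 'I_n00 -> 'M[R[i]]_N.+1) (z01 : 'I_n01 -> 'M[R[i]]_N.+1)
  (z10 : 'I_n10 -> 'M[R[i]]_N.+1) (z11 : 'I_n11 -> 'M[R[i]]_N.+1)
  (v00 : 'I_n00 -> R) (v01 : 'I_n01 -> R)
  (v10 : 'I_n10 -> R) (v11 : 'I_n11 -> R)
  (T00_01 : 'I_n00 -> 'I_n01 -> nat) (T00_10 : 'I_n00 -> 'I_n10 -> nat)
  (T01_11 : 'I_n01 -> 'I_n11 -> nat) (T10_11 : 'I_n10 -> 'I_n11 -> nat)
  (* the four multi-matrix algebras and the unital inclusions *)
  (hA00 : is_unital_star_subalg A00) (hA01 : is_unital_star_subalg A01)
  (hA10 : is_unital_star_subalg A10) (hA11 : is_unital_star_subalg A11)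
  (s00_01 : subalg A00 A01) (s01_11 : subalg A01 A11)
  (s00_10 : subalg A00 A10) (s10_11 : subalg A10 A11)
  (* faithful tracial state and commuting square condition *)
  (htau : is_faithful_tracial_state A11 tau)
  (hE00 : is_cond_exp tau A11 A00 E00)
  (hE01 : is_cond_exp tau A11 A01 E01)
  (hE10 : is_cond_exp tau A11 A10 E10)
  (hcomm : forall x, A11 x -> E01 (E10 x) = E00 x)
  (* simple summands *)
  (hz00 : enumerates_summands A00 z00) (hz01 : enumerates_summands A01 z01)
  (hz10 : enumerates_summands A10 z10) (hz11 : enumerates_summands A11 z11)
  (* trace vectors *)
  (hv00 : is_trace_vector tau A00 z00 v00)
  (hv01 : is_trace_vector tau A01 z01 v01)
  (hv10 : is_trace_vector tau A10 z10 v10)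
  (hv11 : is_trace_vector tau A11 z11 v11)
  (* inclusion matrices *)
  (hT00_01 : is_inclusion_matrix A00 A01 z00 z01 T00_01)
  (hT00_10 : is_inclusion_matrix A00 A10 z00 z10 T00_10)
  (hT01_11 : is_inclusion_matrix A01 A11 z01 z11 T01_11)
  (hT10_11 : is_inclusion_matrix A10 A11 z10 z11 T10_11)
  (p : R) (hp : 1 <= p) (a : 'I_n11 -> R) (ha : forall l, 0 <= a l)
  (i : 'I_n00) :
  (\sum_(j < n10)
      (\sum_(l < n11) (T10_11 j l)%:R * a l * v11 l / v10 j) `^ p
        * ((T00_10 i j)%:R * v10 j / v00 i)) `^ p^-1
  <= \sum_(k < n01)
      (\sum_(l < n11) (T01_11 k l)%:R * a l `^ p * v11 l / v01 k) `^ p^-1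
        * ((T00_01 i k)%:R * v01 k / v00 i).
Proof.
have [[A00z _] z00p z00n0 _] := enumerates_summandsP hz00 i.
have [e [em ez]] := exists_min_proj hA00 _ A00z z00p z00n0.
have [A00e ep e0 _] := em.
have te : tau e = real_complex R (v00 i) by exact: hv00.
have V0 : 0 < v00 i.
  have A11e : A11 e by exact/s01_11/s00_01.
  by have := tau_proj_gt0 htau _ A11e ep e0; rewrite te ltcR.
have [tr10 tr10_11 v10_gt0] :=
  trace_inclusion htau s00_10 s10_11 hz10 hz11 hv10 hv11 hT00_10 hT10_11 em ez.
have [tr01 tr01_11 v01_gt0] :=
  trace_inclusion htau s00_01 s01_11 hz01 hz11 hv01 hv11 hT00_01 hT01_11 em ez.
have zc10 j : is_central A10 (z10 j) by case: (enumerates_summandsP hz10 j).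
have zp10 j : is_proj (z10 j) by case: (enumerates_summandsP hz10 j).
have zc01 k : is_central A01 (z01 k) by case: (enumerates_summandsP hz01 k).
have zp01 k : is_proj (z01 k) by case: (enumerates_summandsP hz01 k).
have zc11 l : is_central A11 (z11 l) by case: (enumerates_summandsP hz11 l).
have zp11 l : is_proj (z11 l) by case: (enumerates_summandsP hz11 l).
have ez01 k : e * z01 k = z01 k * e by rewrite (zc01 k).2//; exact: s00_01.
have zep j : is_proj (z10 j * e).
  by apply: projM => //; rewrite (zc10 j).2//; exact: s00_10.
have A11ze j : A11 (z10 j * e).
  by apply/s10_11/(subalgM hA10); [case: (zc10 j)|exact: s00_10].
have A11z10 j l : A11 (z11 l * (z10 j * e)).
  by apply: (subalgM hA11) => //; case: (zc11 l).
(* The target inequality is real while [tau] is complex-valued; the traces being nonnegative, taking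
   real parts loses nothing. *)
pose w j k l := complex.Re (tau (z11 l * (z10 j * e) * z01 k)).
have tau_ge0 j k l : 0 <= tau (z11 l * (z10 j * e) * z01 k).
  apply: (tau_mul_proj_ge0 hA11 htau) => //; first by case: (zc01 k) => /s01_11.
  by apply: projM => //; rewrite (zc11 l).2.
have wE j k l : real_complex R (w j k l) = tau (z11 l * (z10 j * e) * z01 k).
  by rewrite RRe_real// ger0_real.
have w_ge0 j k l : 0 <= w j k l by rewrite -ler0c wE.
have sum_w_k j l : \sum_k w j k l = (T00_10 i j)%:R * ((T10_11 j l)%:R * v11 l).
  apply: (@complexI R); rewrite rmorph_sum -tr10_11 (eq_bigr _ (fun k _ => wE j k l)).
  by rewrite -(tau_sum htau) -mulr_sumr (sum_summands hA01 _ hz01) mulr1.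
have sum_w_j k l : \sum_j w j k l = (T00_01 i k)%:R * ((T01_11 k l)%:R * v11 l).
  apply: (@complexI R); rewrite rmorph_sum -tr01_11 (eq_bigr _ (fun j _ => wE j k l)).
  rewrite -(tau_sum htau) -mulr_suml -mulr_sumr -mulr_suml.
  by rewrite (sum_summands hA10 _ hz10) mul1r -mulrA ez01.
have sum_w_l j k : \sum_l w j k l =
    ((T00_10 i j)%:R * v10 j) * ((T00_01 i k)%:R * v01 k) / v00 i.
  have [A10z _] := zc10 j; have [A01z _] := zc01 k.
  have := commuting_square_factor hA01 hA10 hA11 s00_01 s01_11 s10_11 htau
    hE00 hE01 hE10 hcomm em A10z A01z (ez01 k).
  rewrite te tr10 tr01 -!rmorphM/= => h.
  apply: (canRL (mulfK (lt0r_neq0 V0))); apply: (@complexI R); rewrite -h rmorphM rmorph_sum.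
  rewrite (eq_bigr _ (fun l _ => wE j k l)) -(tau_sum htau) -!mulr_suml.
  by rewrite (sum_summands hA11 _ hz11) mul1r.
(* An entry of a trace vector is known to be positive only at a nonzero multiplicity; at
   multiplicity zero the weight itself is zero. *)
have weight_ge0 (m : nat) (v : R) : (m != 0 -> 0 < v) -> 0 <= m%:R * v.
  by case: m => [_|m /(_ isT)/ltW v0]; rewrite ?mul0r// mulr_ge0.
(* The multiplicity [m] out of the [i]-th summand of [A00] occurs in both the mass and the weight,
   and cancels. Both sides of the theorem use this, with [j] and [k] exchanged. *)
have average (I : finType) (u : I -> 'I_n11 -> R) (m : nat) (v : R)
    (T : 'I_n11 -> nat) (b : 'I_n11 -> R) :
    (forall l, \sum_k u k l = m%:R * ((T l)%:R * v11 l)) -> m != 0 -> 0 < v ->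
    (\sum_k \sum_l u k l * b l) / (m%:R * v) = \sum_l (T l)%:R * b l * v11 l / v.
  move=> uE m0 v0; rewrite exchange_big mulr_suml; apply: eq_bigr => l _.
  rewrite -mulr_suml uE; field.
  by rewrite pnatr_eq0 m0 gt_eqF.
(* At multiplicity zero the two averages may differ, but the outer weight annihilates both terms. *)
have lhs j : (\sum_l (T10_11 j l)%:R * a l * v11 l / v10 j) `^ p
      * ((T00_10 i j)%:R * v10 j / v00 i)
    = ((\sum_k \sum_l w j k l * a l) / ((T00_10 i j)%:R * v10 j)) `^ p
      * ((T00_10 i j)%:R * v10 j / v00 i).
  have [->|T0] := eqVneq (T00_10 i j) 0%N; first by rewrite !mul0r !mulr0.
  by rewrite (average _ _ _ _ (T10_11 j) a (sum_w_k j))// v10_gt0.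
have rhs k : (\sum_l (T01_11 k l)%:R * a l `^ p * v11 l / v01 k) `^ p^-1
      * ((T00_01 i k)%:R * v01 k / v00 i)
    = ((\sum_j \sum_l w j k l * a l `^ p) / ((T00_01 i k)%:R * v01 k)) `^ p^-1
      * ((T00_01 i k)%:R * v01 k / v00 i).
  have [->|T0] := eqVneq (T00_01 i k) 0%N; first by rewrite !mul0r !mulr0.
  by rewrite (average _ _ _ _ (T01_11 k) (fun l => a l `^ p) (sum_w_j k))// v01_gt0.
rewrite (eq_bigr _ (fun j _ => lhs j)) (eq_bigr _ (fun k _ => rhs k)).
exact: (conditional_minkowski w (fun j => (T00_10 i j)%:R * v10 j)
  (fun k => (T00_01 i k)%:R * v01 k) a hp V0 w_ge0 ha
  (fun j => weight_ge0 _ _ (v10_gt0 j)) (fun k => weight_ge0 _ _ (v01_gt0 k)) sum_w_l).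
Qed.
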